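(* Let $D\in\mathbb{R}^{n\times n}$ be a symmetric matrix that is not positive definite, with smallest eigenvalue $\lambda_{\min}\le0$. If $\lambda_{\min}<0$, a measure $\mu\in\mathcal{P}(\mathcal{S})$ minimizes the energy $\mathcal{E}_D$ over $\mathcal{P}(\mathcal{S})$ if and only if it is a Dirac measure placed at a (normalized) eigenvector of $D$ corresponding to $\lambda_{\min}$. If $\lambda_{\min}=0$, a measure $\mu\in\mathcal{P}(\mathcal{S})$ minimizes $\mathcal{E}_D$ over $\mathcal{P}(\mathcal{S})$ if and only if it is concentrated on the null space of $D$.
   Context: $\mathcal{S}=\{x\in\mathbb{R}^n:\|x\|=1\}$ is the Euclidean unit sphere, $\mathcal{P}(\mathcal{S})$ the set of Borel probability measures on $\mathcal{S}$, and $$\mathcal{E}_D(\mu)=\int_{\mathcal{S}}\int_{\mathcal{S}}e^{x\cdot Dy}\,d\mu(x)\,d\mu(y).$$ A measure $\mu\in\mathcal{P}(\mathcal{S})$ is concentrated on the null space $\mathcal{N}(D)$ if $\mu(\mathcal{S}\cap\mathcal{N}(D))=1$. *)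

(* Defs.v *)
From HB Require Import structures.
From mathcomp Require Import all_boot all_order all_algebra.
From mathcomp Require Import all_classical all_reals all_analysis.

Set Implicit Arguments.
Unset Strict Implicit.
Unset Printing Implicit Defensive.

Import Order.TTheory GRing.Theory Num.Theory.
Import numFieldNormedType.Exports.

Local Open Scope classical_set_scope.
Local Open Scope ring_scope.

Section LinearAlgebra.
Context {R : realType} {n : nat}.

Definition dot (x y : 'cV[R]_n) : R := \sum_(i < n) x i 0 * y i 0.

(* The library norm on ['cV[R]_n] is the sup norm, which induces the same
   topology but not the same unit sphere. *)
Definition enorm (x : 'cV[R]_n) : R := Num.sqrt (dot x x).

Definition posdef (D : 'M[R]_n) : Prop :=
  forall x : 'cV[R]_n, x != 0 -> 0 < dot x (D *m x).

Definition smallest_eigenvalue (D : 'M[R]_n) (l : R) : Prop :=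
  eigenvalue D l /\ forall a : R, eigenvalue D a -> l <= a.

End LinearAlgebra.

Section Sphere.
Variables (R : realType) (n : nat).

Definition unit_sphere : set 'cV[R]_n.+1 := [set x | enorm x = 1].

Lemma unit_sphere_delta : unit_sphere (delta_mx ord0 ord0).
Proof.
rewrite /unit_sphere /= /enorm /dot big_ord_recl big1 => [|i _].
  by rewrite !mxE !eqxx /= mulr1 addr0 sqrtr1.
by rewrite !mxE /= mulr0.
Qed.

Definition sphere : Type := set_type unit_sphere.

(* The topology is the one induced by the inclusion in ['cV[R]_n.+1]. *)
HB.instance Definition _ := Topological.copy sphere (set_type unit_sphere).
HB.instance Definition _ := isPointed.Build sphere
  (exist _ (delta_mx ord0 ord0) (mem_set unit_sphere_delta)).

Definition borel_sphere := g_sigma_algebraType (@open sphere).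

Definition sphere_val (x : borel_sphere) : 'cV[R]_n.+1 := set_val (x : sphere).

End Sphere.

Section Energy.
Context {R : realType} {n : nat}.
Implicit Types (D : 'M[R]_n.+1) (mu : probability (borel_sphere R n) R).

Definition energy D mu : \bar R :=
  (\int[mu]_y \int[mu]_x (expR (dot (sphere_val x) (D *m sphere_val y)))%:E)%E.

Definition minimizes_energy D mu : Prop :=
  forall nu : probability (borel_sphere R n) R, (energy D mu <= energy D nu)%E.

(* A [probability] is a function on all sets, with unconstrained values on
   non-measurable ones: equality of measures is equality on Borel sets. *)
Definition is_dirac_at mu (v : borel_sphere R n) : Prop :=
  forall A : set (borel_sphere R n), measurable A -> mu A = \d_v A.

Definition concentrated_on_null_space D mu : Prop :=
  mu [set x : borel_sphere R n | D *m sphere_val x = 0] = 1%E.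

End Energy.

(* Main.v *)
Require Import Defs.
From mathcomp Require Import all_boot all_order all_algebra.
From mathcomp Require Import all_classical all_reals all_analysis.
From mathcomp Require Import measurable_realfun ring lra.
Import Order.TTheory GRing.Theory Num.Theory.
Import numFieldNormedType.Exports.
Local Open Scope classical_set_scope.
Local Open Scope ring_scope.

(** Write [m] for the barycenter of a probability [mu] on the sphere and [l] for
the smallest eigenvalue of [D]. The double integral of [x . D y] against
[mu x mu] is [m . D m], so Jensen's inequality bounds the energy from below by
[exp (m . D m)] ([energy_ge_barycenter]). Two facts turn this into the theorem:
the Rayleigh bound [l (m . m) <= m . D m] ([eigenvalue_le_rayleigh]), and
[m . m <= 1] ([barycenter_le1]), with equality only if [mu] is concentrated at
the single point [m] ([ae_barycenter]). A Dirac mass at a unit eigenvector for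
[l] has energy [exp l], so a minimizer satisfies [m . D m <= l].

If [l < 0], then [l (m . m) <= m . D m <= l] forces [m . m = 1]; hence [mu] is
the Dirac mass at [m], and [m . D m = l (m . m)] says that [m] is in the kernel
of the positive semidefinite matrix [D - l]. Conversely
[l <= l (m . m) <= m . D m] for every measure, so [exp l] is the minimum.

If [l = 0], the lower bound [exp (m . D m)] is at least [1], and [1] is the
energy of any measure on the null space. A minimizer thus attains equality in
Jensen's inequality, in the form of the tangent inequality [1 + t <= exp t] at
[0]; this makes [x . D y] vanish for almost every [y] and then almost every [x]
([ae_dot_eq0]). Testing that against the second moments [C i] of [mu], the mean
of [x_i x], gives [C i . D (C i) = 0], so [D (C i) = 0] for each [i], and the
mean of [x . D x], which is the trace of [D C], vanishes. As [D] is positive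
semidefinite, [D x = 0] almost everywhere ([ae_dot_eq0_null]).

All integrals are iterated one-variable integrals; Tonelli's theorem enters only
through the measurability of the inner one. *)

(** * The dot product and positive semidefinite matrices *)

Section Dot.
Context {R : realType} {n : nat}.
Implicit Types (x y z : 'cV[R]_n) (A B D : 'M[R]_n).

Lemma dotC x y : dot x y = dot y x.
Proof. by apply: eq_bigr => i _; rewrite mulrC. Qed.

Lemma dotDl x y z : dot (x + y) z = dot x z + dot y z.
Proof. by rewrite -big_split; apply: eq_bigr => i _; rewrite mxE mulrDl. Qed.

Lemma dotZl a x y : dot (a *: x) y = a * dot x y.
Proof. by rewrite /dot mulr_sumr; apply: eq_bigr => i _; rewrite mxE mulrA. Qed.

Lemma dotDr x y z : dot x (y + z) = dot x y + dot x z.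
Proof. by rewrite dotC dotDl !(dotC _ x). Qed.

Lemma dotZr a x y : dot x (a *: y) = a * dot x y.
Proof. by rewrite dotC dotZl dotC. Qed.

Lemma dot0r x : dot x 0 = 0.
Proof. by rewrite -(scale0r (0 : 'cV[R]_n)) dotZr mul0r. Qed.

Lemma dotNl x y : dot (- x) y = - dot x y.
Proof. by rewrite -scaleN1r dotZl mulN1r. Qed.

Lemma dotNr x y : dot x (- y) = - dot x y.
Proof. by rewrite dotC dotNl dotC. Qed.

Lemma dot_ge0 x : 0 <= dot x x.
Proof. by apply: sumr_ge0 => i _; rewrite -expr2 sqr_ge0. Qed.

Lemma dot_eq0 x : dot x x = 0 -> x = 0.
Proof.
move=> /eqP; rewrite psumr_eq0 => [/allP x0|i _]; last by rewrite -expr2 sqr_ge0.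
apply/colP => i; rewrite mxE.
by have := x0 i (mem_index_enum i); rewrite mulf_eq0 orbb => /eqP.
Qed.

Lemma dot_gt0 x : x != 0 -> 0 < dot x x.
Proof.
move=> x0; rewrite lt_def dot_ge0 andbT; apply: contra_neq x0; exact: dot_eq0.
Qed.

Lemma enorm1P x : enorm x = 1 <-> dot x x = 1.
Proof.
rewrite /enorm; split=> [x1|->]; last exact: sqrtr1.
by rewrite -(sqr_sqrtr (dot_ge0 x)) x1 expr1n.
Qed.

Lemma coord_le x i r : dot x x <= r ^+ 2 -> 0 <= r -> `|x i 0| <= r.
Proof.
move=> xr r0; rewrite -(ler_pXn2r (ltn0Sn 1)) ?nnegrE//.
rewrite real_normK ?num_real//; apply: le_trans xr.
rewrite /dot (bigD1 i)//= -expr2 lerDl.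
by apply: sumr_ge0 => j _; rewrite -expr2 sqr_ge0.
Qed.

Lemma dot_mulmx_adj A x y : dot x (A *m y) = dot (A^T *m x) y.
Proof.
rewrite /dot; under eq_bigr do rewrite mxE mulr_sumr.
rewrite exchange_big/=; apply: eq_bigr => j _; rewrite mxE mulr_suml.
by apply: eq_bigr => i _; rewrite mxE; ring.
Qed.

(** A crude substitute for an operator norm; any finite constant bounding the
bilinear form on the unit sphere will do. *)
Definition entrysum A := \sum_i \sum_j `|A i j|.

Lemma entrysum_ge0 A : 0 <= entrysum A.
Proof. by apply: sumr_ge0 => i _; apply: sumr_ge0. Qed.

Lemma bilin_bound A x y r : dot x x <= r ^+ 2 -> dot y y <= r ^+ 2 -> 0 <= r ->
  `|dot x (A *m y)| <= entrysum A * r ^+ 2.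
Proof.
move=> xr yr r0; apply: le_trans (ler_norm_sum _ _ _) _.
rewrite /entrysum mulr_suml; apply: ler_sum => i _.
rewrite normrM mxE expr2 mulrA mulrC.
apply: ler_pM => //; last exact: coord_le.
apply: le_trans (ler_norm_sum _ _ _) _.
rewrite mulr_suml; apply: ler_sum => j _.
by rewrite normrM ler_wpM2l// coord_le.
Qed.

Lemma quad_bound A x : dot x (A *m x) <= entrysum A * dot x x.
Proof.
rewrite (le_trans (ler_norm _))// -[X in _ * X](sqr_sqrtr (dot_ge0 x)).
by apply: bilin_bound; rewrite ?sqr_sqrtr ?dot_ge0.
Qed.

Definition psd A := forall x, 0 <= dot x (A *m x).

(** The Cauchy-Schwarz inequality for the form of [A], in a shape that needs no
square root of [A]: with [K] a bound of the form on unit vectors, expand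
[0 <= z . A z] at [z = x - K^-1 (A x)]. It serves twice, for the kernel of a
positive semidefinite matrix and for the coercivity of an invertible one. *)
Lemma psd_sqr_bound {A} x : A^T = A -> psd A ->
  dot (A *m x) (A *m x) <= (entrysum A + 1) * dot x (A *m x).
Proof.
move=> AT A0; set K := entrysum A + 1; set q := dot x _; set y := A *m x.
have K0 : 0 < K by rewrite ltr_pwDr// entrysum_ge0.
(* The step [K^-1] makes the quadratic term absorb half of the linear one. *)
have := A0 (x - K^-1 *: y).
rewrite mulmxBr -scalemxAr -/y !(dotDl, dotDr, dotNl, dotNr, dotZl, dotZr).
rewrite -/q dot_mulmx_adj AT -/y; set b := dot y y.
have : dot y (A *m y) <= K * b.
  by apply: le_trans (quad_bound _ _) _; rewrite ler_wpM2r ?dot_ge0// lerDl.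
move: (dot y (A *m y)) => c cKb.
rewrite -(pmulr_rge0 _ K0).
have -> : K * (q - K^-1 * b + (- (K^-1 * b) - - (K^-1 * (K^-1 * c)))) =
  K * q - b - b + K^-1 * c by field; rewrite gt_eqF.
have : K^-1 * c <= b by rewrite ler_pdivrMl.
by clear AT A0; lra.
Qed.

Lemma psd_dot_eq0 {A} x : A^T = A -> psd A -> dot x (A *m x) = 0 -> A *m x = 0.
Proof.
move=> AT A0 x0; apply: dot_eq0; apply/eqP; rewrite eq_le dot_ge0 andbT.
by have := psd_sqr_bound x AT A0; rewrite x0 mulr0.
Qed.

(** Combine [psd_sqr_bound] with a bound of [x . x] by a multiple of
[A x . A x], which holds as [x] is the
image of [A x] under the inverse of [A]. *)
Lemma psd_unit_bound {A} : A^T = A -> psd A -> A \in unitmx ->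
  exists2 e, 0 < e & forall x, e * dot x x <= dot x (A *m x).
Proof.
move=> AT A0 uA.
pose C := (invmx A)^T *m invmx A.
pose K := (entrysum C + 1) * (entrysum A + 1).
have K0 : 0 < K by rewrite mulr_gt0// ltr_pwDr// entrysum_ge0.
exists K^-1; first by rewrite invr_gt0.
move=> x; rewrite ler_pdivrMl// /K.
apply: (@le_trans _ _ ((entrysum C + 1) * dot (A *m x) (A *m x))).
  have := quad_bound C (A *m x).
  rewrite /C -mulmxA mulKmx// dot_mulmx_adj trmxK mulKmx// => /le_trans; apply.
  by rewrite ler_wpM2r ?dot_ge0// lerDl.
rewrite -mulrA ler_wpM2l ?addr_ge0 ?entrysum_ge0//; exact: psd_sqr_bound.
Qed.

End Dot.

(** * The Rayleigh bound for the smallest eigenvalue *)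

Section Rayleigh.
Context {R : realType} {n : nat}.
Implicit Types (D : 'M[R]_n.+1).

Lemma symmetricmx_tr D : D \is symmetricmx -> D^T = D.
Proof. by move=> /is_hermitianmxP; rewrite expr0 scale1r map_mx_id. Qed.

(** The library's eigenvectors are rows; symmetry of [D] lets one use columns. *)
Lemma eigenvalueP_col {D a} : D^T = D ->
  reflect (exists2 x : 'cV_n.+1, D *m x = a *: x & x != 0) (eigenvalue D a).
Proof.
move=> DT; apply: (iffP eigenvalueP) => [] [v vD v0]; exists v^T.
- by rewrite -{1}DT -trmx_mul vD linearZ.
- by rewrite trmx_eq0.
- by rewrite -{1}DT -trmx_mul vD linearZ.
- by rewrite trmx_eq0.
Qed.

Lemma unit_eigenvector {D a} : D^T = D -> eigenvalue D a ->
  exists2 x : 'cV_n.+1, D *m x = a *: x & dot x x = 1.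
Proof.
move=> DT /(eigenvalueP_col DT)[x Dx x0].
have xx0 := dot_gt0 _ x0.
exists ((Num.sqrt (dot x x))^-1 *: x).
  by rewrite -scalemxAr Dx !scalerA mulrC.
rewrite dotZl dotZr mulrA -invfM -expr2 sqr_sqrtr ?ltW//.
by rewrite mulVf// gt_eqF.
Qed.

(** Let [c] be the infimum of the Rayleigh quotient. Then [D - c] is positive
semidefinite, and it is singular: otherwise [psd_unit_bound] would raise the
infimum. So [c] is an eigenvalue, whence [l <= c]. *)
Lemma eigenvalue_le_rayleigh {D l} : D^T = D -> smallest_eigenvalue D l ->
  forall x, l * dot x x <= dot x (D *m x).
Proof.
move=> DT [_ lmin].
pose S := [set dot x (D *m x) | x in [set x : 'cV[R]_n.+1 | dot x x = 1]].
pose c := inf S.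
have S0 : S !=set0.
  exists (dot (delta_mx ord0 ord0) (D *m delta_mx ord0 ord0)).
  exists (delta_mx ord0 ord0) => //=; apply/enorm1P; exact: unit_sphere_delta.
have Slb : has_lbound S.
  exists (- entrysum D) => _ [x /= x1 <-].
  have := bilin_bound D x x 1; rewrite expr1n x1 mulr1.
  by move=> /(_ (lexx _) (lexx _) ler01); rewrite ler_norml => /andP[].
have rayleigh b : lbound S b -> forall x, b * dot x x <= dot x (D *m x).
  move=> bS x; have [->|x0] := eqVneq x 0; first by rewrite mulmx0 !dot0r mulr0.
  have xx0 := dot_gt0 _ x0.
  pose u := (Num.sqrt (dot x x))^-1 *: x.
  have q (y z : 'cV[R]_n.+1) a : dot (a *: y) (a *: z) = a ^+ 2 * dot y z.
    by rewrite dotZl dotZr mulrA.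
  have s2 : (Num.sqrt (dot x x))^-1 ^+ 2 = (dot x x)^-1.
    by rewrite exprVn sqr_sqrtr// ltW.
  have Su : S (dot u (D *m u)).
    by exists u => //=; rewrite q s2 mulVf// gt_eqF.
  have := bS _ Su; rewrite -scalemxAr q s2.
  by rewrite ler_pdivlMl// mulrC.
have clb : lbound S c by apply: ge_inf.
have cle : l <= c.
  apply: lmin; apply: contrapT => /negP nc.
  pose B := D - c%:M.
  have BE x : dot x (B *m x) = dot x (D *m x) - c * dot x x.
    by rewrite mulmxBl mul_scalar_mx dotDr dotNr dotZr.
  have B0 : psd B by move=> x; rewrite BE subr_ge0 rayleigh.
  have BT : B^T = B by rewrite /B linearB/= tr_scalar_mx DT.
  have uB : B \in unitmx.
    rewrite -row_free_unit -kermx_eq0.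
    by move: nc; rewrite /eigenvalue /eigenspace negbK.
  have [e e0 eB] := psd_unit_bound BT B0 uB.
  have : c + e <= c.
    apply: lb_le_inf => // _ [x /= x1 <-].
    by have := eB x; rewrite BE x1 !mulr1; lra.
  lra.
by move=> x; apply: le_trans (rayleigh c clb x); rewrite ler_wpM2r ?dot_ge0.
Qed.

End Rayleigh.

(** * Means of bounded measurable functions *)

Section BoundedMeasurable.
Context {d} {T : measurableType d} {R : realType} (P : probability T R).
Implicit Types (f g : T -> R).

(** Unlike integrability, this class is stable under products and depends on no
measure, and each of its members is integrable for every probability. *)
Definition bmeas f := measurable_fun setT f /\ exists M, forall x, `|f x| <= M.

Lemma bmeas_cst c : bmeas (fun=> c).
Proof. by split; [exact: measurable_cst|exists `|c|]. Qed.

Lemma bmeasD f g : bmeas f -> bmeas g -> bmeas (fun x => f x + g x).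
Proof.
move=> [mf [M fM]] [mg [N gN]]; split; first exact: measurable_funD.
by exists (M + N) => x; apply: le_trans (ler_normD _ _) _; apply: lerD.
Qed.

Lemma bmeasM f g : bmeas f -> bmeas g -> bmeas (fun x => f x * g x).
Proof.
move=> [mf [M fM]] [mg [N gN]]; split; first exact: measurable_funM.
by exists (M * N) => x; rewrite normrM ler_pM.
Qed.

Lemma bmeasB f g : bmeas f -> bmeas g -> bmeas (fun x => f x - g x).
Proof.
move=> [mf [M fM]] [mg [N gN]]; split; first exact: measurable_funB.
by exists (M + N) => x; apply: le_trans (ler_normB _ _) _; apply: lerD.
Qed.

Lemma bmeas_sum (I : Type) (s : seq I) (F : I -> T -> R) :
  (forall i, bmeas (F i)) -> bmeas (fun x => \sum_(i <- s) F i x).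
Proof.
move=> bF; elim: s => [|i s IH].
  rewrite (_ : (fun _ => _) = fun=> 0); first exact: bmeas_cst.
  by apply/funext => x; rewrite big_nil.
rewrite (_ : (fun _ => _) = fun x => F i x + \sum_(j <- s) F j x).
  exact: bmeasD.
by apply/funext => x; rewrite big_cons.
Qed.

Lemma bmeas_expR f : bmeas f -> bmeas (fun x => expR (f x)).
Proof.
move=> [mf [M fM]]; split; first exact: measurableT_comp.
exists (expR M) => x; rewrite ger0_norm ?expR_ge0// ler_expR.
exact: le_trans (ler_norm _) (fM x).
Qed.

Lemma bmeas_integrable f : bmeas f -> P.-integrable setT (EFin \o f).
Proof.
move=> [mf [M fM]]; apply: measurable_bounded_integrable => //.
  exact: le_lt_trans (probability_le1 P measurableT) (ltry 1).
exists M; split; first exact: num_real.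
by move=> N MN x _; exact: le_trans (fM x) (ltW MN).
Qed.

Lemma EFin_Rintegral f : bmeas f ->
  (\int[P]_x (f x)%:E)%E = (\int[P]_x f x)%R%:E.
Proof.
move=> bf; rewrite /Rintegral fineK//.
by apply: integrable_fin_num => //; exact: bmeas_integrable.
Qed.

Lemma mean_cst c : \int[P]_x c = c.
Proof. by rewrite Rintegral_cst// [X in fine X]probability_setT mulr1. Qed.

Lemma meanD f g : bmeas f -> bmeas g ->
  \int[P]_x (f x + g x) = \int[P]_x f x + \int[P]_x g x.
Proof. by move=> bf bg; rewrite RintegralD//; exact: bmeas_integrable. Qed.

Lemma meanB f g : bmeas f -> bmeas g ->
  \int[P]_x (f x - g x) = \int[P]_x f x - \int[P]_x g x.
Proof. by move=> bf bg; rewrite RintegralB//; exact: bmeas_integrable. Qed.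

Lemma meanZ c f : bmeas f -> \int[P]_x (c * f x) = c * \int[P]_x f x.
Proof. by move=> bf; rewrite RintegralZl//; exact: bmeas_integrable. Qed.

Lemma mean_sum (I : Type) (s : seq I) (F : I -> T -> R) :
  (forall i, bmeas (F i)) ->
  \int[P]_x (\sum_(i <- s) F i x) = \sum_(i <- s) \int[P]_x F i x.
Proof.
move=> bF; elim: s => [|i s IH].
  rewrite big_nil -[RHS]mean_cst; apply: eq_Rintegral => x _.
  by rewrite big_nil.
rewrite big_cons -IH -meanD//; last exact: bmeas_sum.
by apply: eq_Rintegral => x _; rewrite big_cons.
Qed.

Lemma le_mean f g : bmeas f -> bmeas g -> (forall x, f x <= g x) ->
  \int[P]_x f x <= \int[P]_x g x.
Proof. by move=> bf bg fg; apply: le_Rintegral => //; exact: bmeas_integrable. Qed.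

Lemma ae_eq_mean f g : bmeas f -> bmeas g ->
  {ae P, forall x, f x = g x} -> \int[P]_x f x = \int[P]_x g x.
Proof.
move=> [mf _] [mg _] fg; congr fine; apply: ae_eq_integral => //.
- exact/measurable_EFinP.
- exact/measurable_EFinP.
- by apply: filterS fg => x fgx _ /=; rewrite fgx.
Qed.

Lemma ge0_mean_le0 f : bmeas f -> (forall x, 0 <= f x) ->
  \int[P]_x f x <= 0 -> {ae P, forall x, f x = 0}.
Proof.
move=> bf f0 fle0; have [mf _] := bf.
have : ae_eq P setT (EFin \o f) (cst 0%E).
  apply/ae_eq_integral_abs => //; first exact/measurable_EFinP.
  under eq_integral do rewrite /= ger0_norm//.
  rewrite EFin_Rintegral//; congr EFin; apply/eqP.
  by rewrite eq_le fle0 Rintegral_ge0.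
by apply: filterS => x /(_ I) [].
Qed.

End BoundedMeasurable.

(** * Functions on the sphere *)

Section SphereFunctions.
Context {R : realType} {n : nat}.
Implicit Types (x y : borel_sphere R n) (D : 'M[R]_n.+1) (w : 'cV[R]_n.+1).

Local Notation coord i := (fun x : borel_sphere R n => sphere_val x i 0).

Lemma sphere_dot1 x : dot (sphere_val x) (sphere_val x) = 1.
Proof. by apply/enorm1P; exact: (set_mem (svalP (x : sphere R n))). Qed.

Lemma sphere_surj w : dot w w = 1 -> exists v : borel_sphere R n, sphere_val v = w.
Proof.
move=> /enorm1P w1; have wS : unit_sphere w by [].
by exists (exist _ w (mem_set wS) : sphere R n).
Qed.

Lemma sphere_val_inj : injective (@sphere_val R n).
Proof. exact: val_inj. Qed.

Lemma measurable_coord i : measurable_fun setT (coord i).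
Proof.
apply: (measurability _ (RGenOpens.measurableE R)).
move=> _ [_ [a [b ->] <-]]; rewrite setTI; apply: sub_sigma_algebra.
have /continuousP : continuous (fun x : sphere R n => (set_val x : 'cV[R]_n.+1) i 0).
  move=> x; apply: (@continuous_comp _ _ _ set_val (fun w : 'cV[R]_n.+1 => w i 0)).
    exact: initial_continuous.
  exact: coord_continuous.
by apply; exact: interval_open.
Qed.

Lemma bmeas_coord i : bmeas (coord i).
Proof.
split; first exact: measurable_coord.
by exists 1 => x; apply: coord_le => //; rewrite sphere_dot1 expr1n.
Qed.

Lemma bmeas_dot w : bmeas (fun x : borel_sphere R n => dot (sphere_val x) w).
Proof. by apply: bmeas_sum => i; apply: bmeasM; [exact: bmeas_coord|exact: bmeas_cst]. Qed.

Lemma bmeas_dot_mulmx D w :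
  bmeas (fun y : borel_sphere R n => dot w (D *m sphere_val y)).
Proof.
rewrite (_ : (fun _ => _) = fun y => dot (sphere_val y) (D^T *m w)).
  exact: bmeas_dot.
by apply/funext => y; rewrite dot_mulmx_adj dotC.
Qed.

Lemma measurable_bilinear D : measurable_fun setT
  (fun p : borel_sphere R n * borel_sphere R n =>
     dot (sphere_val p.1) (D *m sphere_val p.2)).
Proof.
apply: measurable_sum => i; apply: measurable_funM.
  exact: (measurableT_comp (measurable_coord i)).
rewrite (_ : (fun _ => _) = fun p : borel_sphere R n * borel_sphere R n =>
   \sum_j D i j * sphere_val p.2 j 0); last by apply/funext => p; rewrite mxE.
apply: measurable_sum => j; apply: measurable_funM => //.
exact: (measurableT_comp (measurable_coord j)).
Qed.

Lemma bilinear_sphere_bound D x y :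
  `|dot (sphere_val x) (D *m sphere_val y)| <= entrysum D.
Proof.
have := bilin_bound D (sphere_val x) (sphere_val y) 1.
by rewrite expr1n !sphere_dot1 mulr1; apply.
Qed.

End SphereFunctions.

(** * Energy, potential and barycenter *)

Section Energy.
Context {R : realType} {n : nat}.
Local Notation S := (borel_sphere R n).
Local Notation "''v' x" := (sphere_val x) (at level 0, x at level 0).
Variables (D : 'M[R]_n.+1).
Implicit Types (mu : probability S R).

Definition potential mu (y : S) := \int[mu]_x expR (dot 'v x (D *m 'v y)).

Lemma bmeas_kernel y : bmeas (fun x : S => expR (dot 'v x (D *m 'v y))).
Proof. apply: bmeas_expR; exact: bmeas_dot. Qed.

(** Measurability in the outer variable is the measurability half of Tonelli's
theorem, applied to the jointly measurable positive kernel. *)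
Lemma bmeas_potential mu : bmeas (potential mu).
Proof.
split.
  pose h (p : S * S) := (expR (dot 'v (p.1) (D *m 'v (p.2))))%:E.
  have mh : measurable_fun setT h.
    apply/measurable_EFinP; apply: measurableT_comp => //.
    exact: measurable_bilinear.
  have h0 p : (0 <= h p)%E by rewrite lee_fin expR_ge0.
  apply: (measurableT_comp (fine_measurable measurableT)).
  exact: (measurable_fun_fubini_tonelli_G (m1 := mu) h mh h0).
exists (expR (entrysum D)) => y; rewrite ger0_norm; last first.
  by apply: Rintegral_ge0 => x _; exact: expR_ge0.
rewrite -[leRHS](mean_cst mu); apply: le_mean.
- exact: bmeas_kernel.
- exact: bmeas_cst.
move=> x; rewrite ler_expR; apply: le_trans (ler_norm _) _.
exact: bilinear_sphere_bound.
Qed.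

(** The kernel is bounded on the sphere, so the energy is finite and real-valued
integrals, which are linear without side conditions at infinity, compute it. *)
Lemma energyE mu : energy D mu = (\int[mu]_y potential mu y)%R%:E.
Proof.
rewrite /energy -EFin_Rintegral; last exact: bmeas_potential.
by apply: eq_integral => y _; rewrite EFin_Rintegral//; exact: bmeas_kernel.
Qed.

Definition moment mu (g : S -> R) : 'cV[R]_n.+1 :=
  \col_i \int[mu]_x (g x * 'v x i 0).

Lemma mean_dot mu g w : bmeas g ->
  \int[mu]_x (g x * dot 'v x w) = dot (moment mu g) w.
Proof.
move=> bg.
under eq_Rintegral do rewrite /dot mulr_sumr.
have bgc i : bmeas (fun x : S => g x * 'v x i 0).
  by apply: bmeasM => //; exact: bmeas_coord.
rewrite mean_sum => [|i]; last first.
  by under eq_fun do rewrite mulrA; apply: bmeasM => //; exact: bmeas_cst.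
apply: eq_bigr => i _; rewrite mxE mulrC -meanZ//.
by apply: eq_Rintegral => x _; ring.
Qed.

Definition barycenter mu := moment mu (fun=> 1).

Lemma mean_dot1 mu w : \int[mu]_x dot 'v x w = dot (barycenter mu) w.
Proof.
rewrite -mean_dot; last exact: bmeas_cst.
by apply: eq_Rintegral => x _; rewrite mul1r.
Qed.

Lemma mean_dot_mulmx mu w :
  \int[mu]_y dot w (D *m 'v y) = dot w (D *m barycenter mu).
Proof.
rewrite dot_mulmx_adj dotC -mean_dot1; apply: eq_Rintegral => y _.
by rewrite dot_mulmx_adj dotC.
Qed.

Lemma mean_tangent mu a :
  \int[mu]_y (1 - a + dot (barycenter mu) (D *m 'v y)) =
  1 - a + dot (barycenter mu) (D *m barycenter mu).
Proof.
rewrite meanD; [|exact: bmeas_cst|exact: bmeas_dot_mulmx].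
by rewrite mean_cst mean_dot_mulmx.
Qed.

Lemma mean_tangent_inner mu a y :
  \int[mu]_x (1 - a + dot 'v x (D *m 'v y)) =
  1 - a + dot (barycenter mu) (D *m 'v y).
Proof.
rewrite meanD; [|exact: bmeas_cst|exact: bmeas_dot].
by rewrite mean_cst mean_dot1.
Qed.

Lemma expR_tangent (a t : R) : expR a * (1 - a + t) <= expR t.
Proof.
rewrite -[in leRHS](subrK a t) expRD mulrC ler_wpM2r ?expR_ge0//.
by apply: le_trans (expR_ge1Dx _); lra.
Qed.

(** Jensen's inequality: integrate twice the tangent inequality at the point
[a = m . D m], which is the mean of the exponent. *)
Lemma energy_ge_barycenter mu :
  ((expR (dot (barycenter mu) (D *m barycenter mu)))%:E <= energy D mu)%E.
Proof.
rewrite energyE lee_fin; set m := barycenter mu; set a := dot m _.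
have {1}-> : expR a = \int[mu]_y (expR a * (1 - a + dot m (D *m 'v y))).
  rewrite meanZ; last by apply: bmeasD; [exact: bmeas_cst|exact: bmeas_dot_mulmx].
  by rewrite mean_tangent -/m -/a subrK mulr1.
apply: le_mean; [|exact: bmeas_potential|].
  apply: bmeasM; first exact: bmeas_cst.
  by apply: bmeasD; [exact: bmeas_cst|exact: bmeas_dot_mulmx].
move=> y; rewrite -mean_tangent_inner -meanZ; last first.
  by apply: bmeasD; [exact: bmeas_cst|exact: bmeas_dot].
apply: le_mean; [|exact: bmeas_kernel|by move=> x; exact: expR_tangent].
apply: bmeasM; first exact: bmeas_cst.
by apply: bmeasD; [exact: bmeas_cst|exact: bmeas_dot].
Qed.

(** The mean of [|x - m|^2] is [1 - m . m], but integrating the pointwise bound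
[2 (x . m) <= 1 + m . m] is enough. *)
Lemma barycenter_le1 mu : dot (barycenter mu) (barycenter mu) <= 1.
Proof.
set m := barycenter mu.
have : 0 <= \int[mu]_x (1 + dot m m - 2 * dot 'v x m).
  apply: Rintegral_ge0 => x _; have := dot_ge0 ('v x - m).
  by rewrite !(dotDl, dotDr, dotNl, dotNr) sphere_dot1 (dotC m); lra.
rewrite meanB; [|exact: bmeas_cst|by apply: bmeasM; [exact: bmeas_cst|exact: bmeas_dot]].
rewrite mean_cst meanZ; last exact: bmeas_dot.
by rewrite mean_dot1 -/m; lra.
Qed.

(** When [m . m = 1] the variance of [mu] vanishes. *)
Lemma ae_barycenter mu : dot (barycenter mu) (barycenter mu) = 1 ->
  {ae mu, forall x, 'v x = barycenter mu}.
Proof.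
set m := barycenter mu => m1.
have bf : bmeas (fun x : S => 1 - dot 'v x m).
  by apply: bmeasB; [exact: bmeas_cst|exact: bmeas_dot].
have fE x : 2 * (1 - dot 'v x m) = dot ('v x - m) ('v x - m).
  by rewrite !(dotDl, dotDr, dotNl, dotNr) sphere_dot1 (dotC m) m1; lra.
have : {ae mu, forall x, 1 - dot 'v x m = 0}.
  apply: ge0_mean_le0 => //.
    by move=> x; have := dot_ge0 ('v x - m); rewrite -fE; lra.
  rewrite meanB; [|exact: bmeas_cst|exact: bmeas_dot].
  by rewrite mean_cst mean_dot1 m1 subrr.
apply: filterS => x x0; apply/eqP; rewrite -subr_eq0; apply/eqP/dot_eq0.
by rewrite -fE x0 mulr0.
Qed.

(** A Borel set that misses [v] lies in the exceptional null set; this applies to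
[A] or to its complement. *)
Lemma ae_eq_is_dirac mu v : {ae mu, forall x, x = v} -> is_dirac_at mu v.
Proof.
move=> aev A mA; rewrite diracE.
have null B : measurable B -> ~ B v -> mu B = 0%E.
  move=> mB Bv; apply/negligibleP => //.
  by apply: negligibleS aev => x Bx /= xv; apply: Bv; rewrite -xv.
case: (boolP (v \in A)) => [/set_mem Av|/negP vA]; last first.
  by rewrite null// => /mem_set.
rewrite -(setCK A) probability_setC; last exact: measurableC.
by rewrite (null (~` A)) ?sube0//; exact: measurableC.
Qed.

Lemma energy_dirac mu v : is_dirac_at mu v ->
  energy D mu = (expR (dot 'v v (D *m 'v v)))%:E.
Proof.
move=> muv.
have mean f : bmeas f -> \int[mu]_x f x = f v.
  move=> [mf _]; rewrite /Rintegral (eq_measure_integral (\d_v)); last first.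
    by move=> A mA _; exact: muv.
  rewrite integral_dirac//; last exact/measurable_EFinP.
  by rewrite diracE in_setT mul1e.
rewrite energyE mean; last exact: bmeas_potential.
by rewrite /potential mean//; exact: bmeas_kernel.
Qed.

Lemma dirac_minimizer_bound mu (v : S) : minimizes_energy D mu ->
  (energy D mu <= (expR (dot 'v v (D *m 'v v)))%:E)%E.
Proof.
move=> /(_ (\d_v : probability S R)) /le_trans; apply.
by rewrite (@energy_dirac _ v).
Qed.

End Energy.

(** * The null space and equality in Jensen's inequality *)

Section NullSpace.
Context {R : realType} {n : nat}.
Local Notation S := (borel_sphere R n).
Local Notation "''v' x" := (sphere_val x) (at level 0, x at level 0).
Variables (D : 'M[R]_n.+1).
Implicit Types (mu : probability S R).

Lemma measurable_null_space : measurable [set x : S | D *m 'v x = 0].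
Proof.
rewrite (_ : [set _ | _] =
  setT `&` (fun x : S => dot (D *m 'v x) (D *m 'v x)) @^-1` [set 0]); last first.
  rewrite setTI; apply/seteqP; split=> x /= => [->|]; first exact: dot0r.
  exact: dot_eq0.
have mDx i : measurable_fun setT (fun x : S => (D *m 'v x) i 0).
  rewrite (_ : (fun _ => _) = fun x : S => \sum_j D i j * 'v x j 0); last first.
    by apply/funext => x; rewrite mxE.
  apply: measurable_sum => j; apply: measurable_funM => //.
  exact: measurable_coord.
suff mf : measurable_fun setT (fun x : S => dot (D *m 'v x) (D *m 'v x)).
  exact: mf.
by apply: measurable_sum => i; apply: measurable_funM.
Qed.

Lemma concentrated_on_null_spaceP mu :
  concentrated_on_null_space D mu <-> {ae mu, forall x, D *m 'v x = 0}.
Proof.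
have mN := measurable_null_space; set N := [set x | _] in mN.
have muC := probability_setC mu mN.
rewrite /concentrated_on_null_space -/N; split=> [N1|aeN].
  exists (~` N); split => //; first exact: measurableC.
  by rewrite muC N1 subee.
rewrite -(setCK N) probability_setC; last exact: measurableC.
suff -> : mu (~` N) = 0%E by rewrite sube0.
by apply/negligibleP => //; exact: measurableC.
Qed.

Lemma energy_null mu : {ae mu, forall y, D *m 'v y = 0} -> energy D mu = 1%:E.
Proof.
move=> aeN; rewrite energyE; congr EFin.
rewrite -[RHS](mean_cst mu); apply: ae_eq_mean.
- exact: bmeas_potential.
- exact: bmeas_cst.
apply: filterS aeN => y y0; rewrite /potential y0.
by under eq_Rintegral do rewrite dot0r expR0; rewrite mean_cst.
Qed.

(** The gap [exp t - (1 + t)] is nonnegative and vanishes only at [t = 0]. Its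
double mean is [energy - 1 - m . D m <= 0], so the inner mean vanishes for
almost every [y], and then the gap for almost every [x]. *)
Lemma ae_dot_eq0 mu : psd D -> (energy D mu <= 1%:E)%E ->
  {ae mu, forall y, {ae mu, forall x, dot 'v x (D *m 'v y) = 0}}.
Proof.
move=> D0; rewrite energyE lee_fin => E1.
have bt y : bmeas (fun x : S => 1 + dot 'v x (D *m 'v y)).
  by apply: bmeasD; [exact: bmeas_cst|exact: bmeas_dot].
have bt2 : bmeas (fun y : S => 1 + dot (barycenter mu) (D *m 'v y)).
  by apply: bmeasD; [exact: bmeas_cst|exact: bmeas_dot_mulmx].
have gapE y : \int[mu]_x (expR (dot 'v x (D *m 'v y)) - (1 + dot 'v x (D *m 'v y)))
    = potential D mu y - (1 + dot (barycenter mu) (D *m 'v y)).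
  rewrite meanB//; last exact: bmeas_kernel.
  by have := mean_tangent_inner D mu 0 y; rewrite subr0 => ->.
have gap0 y x : 0 <= expR (dot 'v x (D *m 'v y)) - (1 + dot 'v x (D *m 'v y)).
  by rewrite subr_ge0 expR_ge1Dx.
have : {ae mu, forall y, potential D mu y - (1 + dot (barycenter mu) (D *m 'v y)) = 0}.
  apply: ge0_mean_le0.
  - by apply: bmeasB => //; exact: bmeas_potential.
  - by move=> y; rewrite -gapE Rintegral_ge0.
  - rewrite meanB//; last exact: bmeas_potential.
    have := mean_tangent D mu 0; rewrite subr0 => ->.
    by have := D0 (barycenter mu); lra.
apply: filterS => y y0.
have : {ae mu, forall x, expR (dot 'v x (D *m 'v y)) - (1 + dot 'v x (D *m 'v y)) = 0}.
  apply: ge0_mean_le0 => //; last by rewrite gapE y0.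
  by apply: bmeasB => //; exact: bmeas_kernel.
apply: filterS => x /eqP; rewrite subr_eq0 => /eqP expE.
apply/eqP/negPn/negP => /expR_gt1Dx; rewrite expE; lra.
Qed.

(** With [C i] the mean of [x_i x]: the hypothesis gives [C i . D y = 0] for almost
every [y]; multiplying by [y_i] and integrating, [C i . D (C i) = 0], so
[D (C i) = 0]. The mean of [y . D y] is the sum over [i] of the entries [i] of
[D (C i)], hence zero, while its integrand is nonnegative. *)
Lemma ae_dot_eq0_null mu : D^T = D -> psd D ->
  {ae mu, forall y, {ae mu, forall x, dot 'v x (D *m 'v y) = 0}} ->
  {ae mu, forall y, D *m 'v y = 0}.
Proof.
move=> DT D0 ae0.
pose C i := moment mu (fun x => 'v x i 0).
have CD i : {ae mu, forall y, dot 'v y (D *m C i) = 0}.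
  apply: filterS ae0 => y aex.
  rewrite dot_mulmx_adj DT dotC -mean_dot; last exact: bmeas_coord.
  rewrite -[RHS](mean_cst mu); apply: ae_eq_mean; last first.
  - by apply: filterS aex => x ->; rewrite mulr0.
  - exact: bmeas_cst.
  - by apply: bmeasM; [exact: bmeas_coord|exact: bmeas_dot].
have DC0 i : D *m C i = 0.
  apply: psd_dot_eq0 => //.
  rewrite -mean_dot; last exact: bmeas_coord.
  rewrite -[RHS](mean_cst mu); apply: ae_eq_mean; last first.
  - by apply: filterS (CD i) => x ->; rewrite mulr0.
  - exact: bmeas_cst.
  - by apply: bmeasM; [exact: bmeas_coord|exact: bmeas_dot].
have bq i : bmeas (fun y : S => 'v y i 0 * dot 'v y (D *m delta_mx i 0)).
  by apply: bmeasM; [exact: bmeas_coord|exact: bmeas_dot].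
have qE y : dot 'v y (D *m 'v y) = \sum_i 'v y i 0 * dot 'v y (D *m delta_mx i 0).
  rewrite dot_mulmx_adj DT; apply: eq_bigr => i _.
  rewrite dot_mulmx_adj DT mulrC; congr (_ * _).
  rewrite /dot (bigD1 i)//= big1 ?addr0 => [|j ji]; first by rewrite [X in _ * X]mxE !eqxx mulr1.
  by rewrite [X in _ * X]mxE (negbTE ji) mulr0.
have : {ae mu, forall y, dot 'v y (D *m 'v y) = 0}.
  apply: ge0_mean_le0 => //.
    by under eq_fun do rewrite qE; exact: bmeas_sum.
  under eq_Rintegral do rewrite qE.
  rewrite mean_sum// big1// => i _.
  by rewrite mean_dot; [rewrite dot_mulmx_adj DT DC0 dotC dot0r|exact: bmeas_coord].
by apply: filterS => y; exact: psd_dot_eq0.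
Qed.

End NullSpace.

(** * Minimizers of the energy *)

Theorem theorem3p4 (R : realType) (n : nat) (D : 'M[R]_n.+1) (lmin : R)
    (D_sym : D \is symmetricmx) (D_npos : ~ posdef D)
    (lminP : smallest_eigenvalue D lmin) (lmin_le0 : lmin <= 0) :
  (lmin < 0 -> forall mu : probability (borel_sphere R n) R,
     minimizes_energy D mu <->
     exists v : borel_sphere R n,
       D *m sphere_val v = lmin *: sphere_val v /\ is_dirac_at mu v) /\
  (lmin = 0 -> forall mu : probability (borel_sphere R n) R,
     minimizes_energy D mu <-> concentrated_on_null_space D mu).
Proof.
have DT := symmetricmx_tr D D_sym.
have rayleigh := eigenvalue_le_rayleigh DT lminP.
have [w Dw w1] := unit_eigenvector DT (proj1 lminP).
have [u uw] := sphere_surj w w1.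
have min_le mu : minimizes_energy D mu -> (energy D mu <= (expR lmin)%:E)%E.
  by move=> /(dirac_minimizer_bound D mu u); rewrite uw Dw dotZr w1 mulr1.
split=> [l0|l0] mu.
- set m := barycenter mu; split=> [mumin|[v [Dv muv]] nu]; last first.
    rewrite (energy_dirac D mu v muv) Dv dotZr sphere_dot1 mulr1.
    apply: le_trans (energy_ge_barycenter D nu); rewrite lee_fin ler_expR.
    apply: le_trans (rayleigh _); have := barycenter_le1 nu; nra.
  have qm : dot m (D *m m) <= lmin.
    rewrite -ler_expR -lee_fin; apply: le_trans (min_le _ mumin).
    exact: energy_ge_barycenter.
  have m1 : dot m m = 1.
    apply/eqP; rewrite eq_le barycenter_le1/=.
    rewrite -(ler_nM2l l0) mulr1; exact: le_trans (rayleigh m) qm.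
  have [v vm] := sphere_surj m m1.
  exists v; split; last first.
    apply: ae_eq_is_dirac; apply: filterS (ae_barycenter mu m1) => x xm.
    by apply: sphere_val_inj; rewrite xm vm.
  (* The Rayleigh quotient attains its minimum at [m], so [m] is an eigenvector. *)
  pose B := D - lmin%:M.
  have BE x : dot x (B *m x) = dot x (D *m x) - lmin * dot x x.
    by rewrite mulmxBl mul_scalar_mx dotDr dotNr dotZr.
  have : B *m m = 0.
    apply: psd_dot_eq0.
    - by rewrite /B linearB/= tr_scalar_mx DT.
    - by move=> x; rewrite BE subr_ge0.
    apply/eqP; rewrite BE subr_eq0 eq_le rayleigh andbT.
    by rewrite m1 mulr1.
  by rewrite mulmxBl mul_scalar_mx vm => /eqP; rewrite subr_eq0 => /eqP.
- have D0 : psd D by move=> x; rewrite (le_trans _ (rayleigh x))// l0 mul0r.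
  split=> [mumin|/concentrated_on_null_spaceP munull nu].
    apply/concentrated_on_null_spaceP/ae_dot_eq0_null => //.
    apply: ae_dot_eq0 => //.
    by have := min_le _ mumin; rewrite l0 expR0.
  rewrite energy_null//; apply: le_trans (energy_ge_barycenter D nu).
  by rewrite lee_fin -[1]expR0 ler_expR.
Qed.
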